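(* Let $\ell=\sum_{i=1}^m c_i|\phi_i(V_i)|$ be a linear combination with $m\ge1$. Then there exists a finite structure $\mathbf{D}$ such that $\ell(\mathbf{D})=\sum_{i=1}^m c_i|\phi_i(\mathbf{D})|\neq 0$.
   Context: Fix a relational signature $\tau$ (no equality); structures are finite $\tau$-structures. A pp-formula is built from atoms $R(v_1,\dots,v_k)$ using $\wedge$ and $\exists$. A pp-formula $\phi(V)$ has a set of liberal variables $V\supseteq\mathrm{free}(\phi)$, and $\phi(\mathbf{B})$ is the set of assignments $f:V\to B$ with $\mathbf{B},f\models\phi$. Two formulas $\phi(V),\phi'(V')$ are counting equivalent if $|\phi(\mathbf{B})|=|\phi'(\mathbf{B})|$ for every finite structure $\mathbf{B}$. A linear combination is an expression $\sum_{i=1}^m c_i|\phi_i(V_i)|$ where each $c_i$ is a non-zero rational number and the $\phi_i(V_i)$ are pp-formulas over $\tau$ that are pairwise not counting equivalent; it induces the map $\mathbf{B}\mapsto\sum_i c_i|\phi_i(\mathbf{B})|$. *)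

(* Defs.v *)
From HB Require Import structures.
From mathcomp Require Import all_boot all_order all_algebra finmap.
Set Implicit Arguments. Unset Strict Implicit. Unset Printing Implicit Defensive.

Record signature := Signature { symbol : Type; arity : symbol -> nat }.

Record structure (tau : signature) := Structure {
  carrier : finType;
  carrier_gt0 : 0 < #|carrier|;
  interp : forall R : symbol tau, {set (arity R).-tuple carrier}
}.

(* Variables are named by natural numbers; there is no equality atom. *)
Inductive pp_formula (tau : signature) : Type :=
| Atom (R : symbol tau) (vs : (arity R).-tuple nat)
| And (phi psi : pp_formula tau)
| Ex (x : nat) (phi : pp_formula tau).

Fixpoint free (tau : signature) (phi : pp_formula tau) : {fset nat} :=
  match phi with
  | Atom _ vs => [fset x in tval vs]%fset
  | And phi1 phi2 => (free phi1 `|` free phi2)%fset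
  | Ex x phi1 => (free phi1 `\ x)%fset
  end.

Definition update (B : Type) (e : nat -> option B) (x : nat) (b : B) :=
  fun y => if y == x then Some b else e y.

(* Assignments are partial: [e x = None] means that x is unassigned. An atom
   holds when all its variables are assigned and their values are related. *)
Fixpoint sat (tau : signature) (B : structure tau) (phi : pp_formula tau)
    (e : nat -> option (carrier B)) : bool :=
  match phi with
  | Atom R vs => [exists t in interp B R, map e vs == map Some t]
  | And phi1 phi2 => sat phi1 e && sat phi2 e
  | Ex x phi1 => [exists b : carrier B, sat phi1 (update e x b)]
  end.

Record liberal_formula (tau : signature) := LiberalFormula {
  formula : pp_formula tau;
  liberal : {fset nat};
  free_liberal : (free formula `<=` liberal)%fset
}.

Definition assignment (B : Type) (V : {fset nat}) (f : {ffun V -> B}) :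
    nat -> option B :=
  fun x => omap f (insub x).

Definition answers (tau : signature) (phi : liberal_formula tau)
    (B : structure tau) : {set {ffun liberal phi -> carrier B}} :=
  [set f | sat (formula phi) (assignment f)].

Definition counting_equivalent (tau : signature)
    (phi psi : liberal_formula tau) : Prop :=
  forall B : structure tau, #|answers phi B| = #|answers psi B|.

(* Main.v *)
Require Import Defs.
From HB Require Import structures.
From mathcomp Require Import all_boot all_order all_algebra finmap.
From Stdlib Require Import Classical_Prop.
Set Implicit Arguments. Unset Strict Implicit. Unset Printing Implicit Defensive.
Local Open Scope ring_scope.

(** Direct product makes the class of structures a monoid (up to isomorphism),
    and B |-> |phi(B)| is a multiplicative map on it, equal to 1 on the
    one-element structure whose relations are all full. Pairwise inequivalent
    formulas thus give pairwise distinct characters, and these are linearly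
    independent by Dedekind's argument. *)

Import GRing.Theory.

(** Induction on the size of the support of [c]: multiplicativity turns a vanishing relation into
    another one with strictly smaller support. *)
Lemma dedekind_independence (S : Type) (op : S -> S -> S) (e : S)
    (K : idomainType) (I : finType) (f : I -> S -> K)
    (fM : forall i x y, f i (op x y) = f i x * f i y)
    (f1 : forall i, f i e = 1)
    (f_inj : forall i j, i <> j -> ~ (f i =1 f j)) (c : I -> K) :
  (forall x, \sum_i c i * f i x = 0) -> forall i, c i = 0.
Proof.
have [n] := ubnP #|[set i | c i != 0]|.
elim: n c => // n IHn c lt_n c_f0 k.
apply/eqP/negPn/negP => ck_neq0.
have c0 j : j != k -> c j = 0.
  move=> /eqP neq_jk; apply/eqP/negPn/negP => cj_neq0.
  apply: (f_inj _ _ neq_jk) => x.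
  (* Subtracting [f k x] times the relation at [y] from the relation at [op x y] gives these new
     coefficients; [k] leaves the support and no index enters it. *)
  have /IHn d0 : (#|[set i | (c i * (f i x - f k x) != 0)%R]| < n)%N.
    apply: leq_trans (ltnSE lt_n); apply: proper_card; apply/properP; split.
      apply/subsetP => i; rewrite !inE.
      by apply: contraNneq => ->; rewrite mul0r.
    by exists k; rewrite !inE // subrr mulr0 eqxx.
  apply/eqP; rewrite -subr_eq0.
  have /eqP : c j * (f j x - f k x) = 0.
    apply: d0 => y.
    transitivity (\sum_i c i * f i (op x y) - f k x * \sum_i c i * f i y).
      rewrite big_distrr -sumrB /=; apply: eq_bigr => i _.
      by rewrite fM mulrBr mulrBl mulrA mulrA [f k x * _]mulrC.
    by rewrite !c_f0 mulr0 subrr.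
  by rewrite mulf_eq0 (negPf cj_neq0).
(* Only the [k] term survives, and at [e] it equals [c k]. *)
have := c_f0 e; rewrite (bigD1 k) //= big1 => [|j /c0 ->]; last by rewrite mul0r.
by rewrite f1 mulr1 addr0; apply/eqP.
Qed.

Section Structures.

Variable tau : signature.
Implicit Types (A B : structure tau) (psi : pp_formula tau).

Lemma full_point_gt0 : (0 < #|{: unit}|)%N.
Proof. by rewrite card_unit. Qed.

Definition full_point : structure tau :=
  Structure full_point_gt0 (fun R => [set: (arity R).-tuple unit]).

Lemma prod_carrier_gt0 A B : (0 < #|{: carrier A * carrier B}|)%N.
Proof. by rewrite card_prod muln_gt0 !carrier_gt0. Qed.

Definition prod_structure A B : structure tau :=
  Structure (prod_carrier_gt0 A B)
    (fun R => [set t : (arity R).-tuple (carrier A * carrier B) |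
       ([tuple of map fst t] \in interp A R) &&
       ([tuple of map snd t] \in interp B R)]).

(** Stands in for functional extensionality: the environments compared below agree only
    pointwise. *)
Lemma eq_sat B psi (e1 e2 : nat -> option (carrier B)) :
  e1 =1 e2 -> sat psi e1 = sat psi e2.
Proof.
elim: psi e1 e2 => [R vs|psi1 IH1 psi2 IH2|x psi IH] e1 e2 eq_e /=.
- by apply: eq_existsb => t; rewrite (eq_map eq_e).
- by rewrite (IH1 _ _ eq_e) (IH2 _ _ eq_e).
- by apply: eq_existsb => b; apply: IH => y; rewrite /update eq_e.
Qed.

(** Glues the tuples witnessing an atom in the two factors into one tuple of pairs. *)
Lemma map_some_zip (T T1 T2 : Type) (e : T -> option (T1 * T2)) s t1 t2 :
  map (omap fst \o e) s = map Some t1 -> map (omap snd \o e) s = map Some t2 ->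
  map e s = map Some (zip t1 t2).
Proof.
elim: s t1 t2 => [|x s IHs] [|a t1] [|b t2] //= [ea /IHs es1] [eb /es1 ->].
by case: (e x) ea eb => [[u v]|] //= [->] [->].
Qed.

(** Conjunction and existential quantification both respect products: a witness in the product is a
    pair of independently chosen witnesses. *)
Lemma sat_prod A B psi (e : nat -> option (carrier A * carrier B)) :
  sat (B := prod_structure A B) psi e =
  sat (B := A) psi (omap fst \o e) && sat (B := B) psi (omap snd \o e).
Proof.
elim: psi e => [R vs|psi1 IH1 psi2 IH2|x psi IH] e /=.
- apply/existsP/andP => [[t]|[]].
    rewrite inE => /andP[/andP[tA tB] /eqP e_t].
    split; apply/existsP; [exists [tuple of map fst t] | exists [tuple of map snd t]].
      by rewrite tA map_comp e_t -!map_comp eqxx.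
    by rewrite tB map_comp e_t -!map_comp eqxx.
  move=> /existsP[t1 /andP[t1A /eqP e_t1]] /existsP[t2 /andP[t2B /eqP e_t2]].
  exists [tuple of zip t1 t2]; rewrite inE (map_some_zip e_t1 e_t2) eqxx andbT.
  have -> : [tuple of map fst (zip t1 t2)] = t1.
    by apply: val_inj; apply: unzip1_zip; rewrite !size_tuple.
  have -> : [tuple of map snd (zip t1 t2)] = t2.
    by apply: val_inj; apply: unzip2_zip; rewrite !size_tuple.
  by rewrite t1A.
- by rewrite IH1 IH2 andbACA.
- have updE (T : Type) (h : carrier A * carrier B -> T) b :
      omap h \o update e x b =1 update (omap h \o e) x (h b).
    by move=> y; rewrite /update /=; case: eqP.
  apply/existsP/andP => [[b]|[/existsP[a sat_a] /existsP[b sat_b]]].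
    rewrite IH => /andP[sat_a sat_b].
    split; apply/existsP; [exists b.1 | exists b.2].
      by rewrite -(eq_sat _ (updE _ _ _)).
    by rewrite -(eq_sat _ (updE _ _ _)).
  exists (a, b); rewrite IH.
  by rewrite (eq_sat (B := A) _ (updE _ _ _)) (eq_sat (B := B) _ (updE _ _ _)) sat_a.
Qed.

(** Relations are full, so an atom could fail only through an unassigned variable, which the
    hypothesis on [e] excludes. *)
Lemma sat_full_point psi (e : nat -> option unit) :
  (forall x, x \in Defs.free psi -> e x) -> sat (B := full_point) psi e.
Proof.
elim: psi e => [R vs|psi1 IH1 psi2 IH2|x psi IH] e /= e_def.
- apply/existsP; exists [tuple of map (fun=> tt) vs]; rewrite inE /=.
  rewrite -map_comp; apply/eqP/eq_in_map => x x_vs /=.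
  have /e_def : x \in [fset y in tval vs]%fset by rewrite inE.
  by case: (e x) => [[]|].
- by rewrite IH1 ?IH2 // => x x_free; apply: e_def; rewrite inE x_free ?orbT.
- apply/existsP; exists tt; apply: IH => y y_free; rewrite /update.
  by case: eqP => // /eqP neq_yx; apply: e_def; rewrite !inE neq_yx.
Qed.

Implicit Type phi : liberal_formula tau.

Lemma card_answers_full_point phi : #|answers phi full_point| = 1%N.
Proof.
have -> : answers phi full_point = setT.
  apply/setP => f; rewrite !inE; apply: sat_full_point => x.
  move/(fsubsetP (free_liberal phi)) => x_lib.
  by rewrite /assignment insubT.
by rewrite cardsT card_ffun card_unit exp1n.
Qed.

Lemma card_answers_prod phi A B :
  #|answers phi (prod_structure A B)| = (#|answers phi A| * #|answers phi B|)%N.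
Proof.
(* An assignment into the product is a pair of assignments; by [sat_prod] this bijection matches the
   answer sets. *)
pose V := liberal phi.
pose split (f : {ffun V -> carrier A * carrier B}) :=
  ([ffun v => (f v).1] : {ffun V -> carrier A},
   [ffun v => (f v).2] : {ffun V -> carrier B}).
pose join (g : {ffun V -> carrier A} * {ffun V -> carrier B}) :=
  [ffun v => (g.1 v, g.2 v)].
have splitK : cancel split join.
  by move=> f; apply/ffunP => v; rewrite !ffunE -surjective_pairing.
have joinK : cancel join split.
  by case=> g h; congr (_, _); apply/ffunP => v; rewrite !ffunE.
rewrite -cardsX -(on_card_preimset (f := split)); last first.
  by apply: onW_bij; exists join.
apply: eq_card => f; rewrite !inE sat_prod.
by congr (_ && _); apply: eq_sat => x; rewrite /assignment /=;
  case: insubP => //= v _ _; rewrite ffunE.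
Qed.

End Structures.

Theorem theorem5p1 (tau : signature) (m : nat) (c : 'I_m -> rat)
    (phi : 'I_m -> liberal_formula tau)
    (c_neq0 : forall i : 'I_m, c i <> 0)
    (phi_inequiv : forall i j : 'I_m,
       i <> j -> ~ counting_equivalent (phi i) (phi j))
    (m_ge1 : (1 <= m)%N) :
  exists D : structure tau,
    \sum_(i < m) c i * (#|answers (phi i) D|)%:R <> 0.
Proof.
(* If the combination vanished on every structure, independence would force even the coefficient at
   index 0 to vanish. *)
apply: NNPP => no_D; apply: (c_neq0 (Ordinal m_ge1)).
apply: (@dedekind_independence _ (@prod_structure tau) (full_point tau) _ _
  (fun i D => #|answers (phi i) D|%:R)).
- by move=> i A B; rewrite card_answers_prod natrM.
- by move=> i; rewrite card_answers_full_point.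
- move=> i j /phi_inequiv neq_ij eq_ij; apply: neq_ij => D.
  (* Counts equal as rationals are equal as naturals, since [rat] has characteristic zero. *)
  by apply/eqP; rewrite -(Num.Theory.eqr_nat rat); apply/eqP/eq_ij.
- by move=> D; apply/eqP/negPn/negP => /eqP D_neq0; apply: no_D; exists D.
Qed.
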